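(* Let $G$ be a discrete group, let $T$ be a compactum with $|T|\ge3$, and let $G\curvearrowright T$ be an $\mathsf{RH}_{32}$-action, i.e. an action by homeomorphisms that is proper on triples, cocompact on pairs and has at least two limit points. Let $\widetilde T=G+_GT$ be the attractor sum of $T$ and $G$, and let $M\subset\widetilde T$ be the set of non-conical points of the action $G\curvearrowright\widetilde T$. If the $G$-set $M$ is connected, then the uniformity of $\widetilde T$ induces a relatively hyperbolic uniformity on $M$.
   Context: A compactum is a compact Hausdorff space. $\Theta^nT$ is the space of $n$-element subsets of $T$. An action of a discrete group $G$ on $T$ is proper on triples if for every compact $K\subset\Theta^3T$ the set $\{g: gK\cap K\ne\varnothing\}$ is finite, and cocompact on pairs if there is a compact $K\subset\Theta^2T$ with $GK=\Theta^2T$. Attractor sum: $G+_GT$ is the disjoint union $G\sqcup T$, with $G$ acting on itself by left multiplication, equipped with the unique compact Hausdorff topology that induces the discrete topology on $G$ and the original topology on $T$ and for which the $G$-action is proper on triples. Limit points, cones, conical points: let $G$ act on a compactum $X$ ($|X|\ge3$) properly on triples. For $S\subset G$ let $\partial S$ be the set of $(r,a)\in X\times X$ such that the cross $(\{r\}\times X)\cup(X\times\{a\})$ belongs to the closure of the set of graphs of $x\mapsto gx$, $g\in S$, in the space of closed subsets of $X\times X$ with the Vietoris topology; $\partial_0S$ and $\partial_1S$ are the projections of $\partial S$ to the first and second factor. The limit points of the action are the points of $\partial_1G$ ($=\partial_0G$). An infinite $S\subset G$ is a cone if $\partial_1S\cap\overline{\{gx:g\in S,\,x\in\partial_0S\}}=\varnothing$;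 then $\partial_0S$ is a single point, the vertex of $S$. A point is conical if it is the vertex of a cone. Uniformities are regarded as filters on the set $\mathsf S^2M$ of unordered pairs (repetition allowed) of points of $M$; the uniformity of a compactum is the filter of neighborhoods of the diagonal, and a subset carries the induced uniformity. For $\mathbf u\subset\mathsf S^2M$ containing the diagonal $\Delta^2M$, $\mathbf u^2$ is the set of pairs $\{x,y\}$ with $\{x,z\},\{z,y\}\in\mathbf u$ for some $z\in M$. A $G$-set $M$ is connected if there is a connected graph with vertex set $M$ on which $G$ acts by automorphisms extending the action on $M$, with finitely many $G$-orbits of edges. A divider on $M$ is a set $\mathbf u\subset\mathsf S^2M$ containing $\Delta^2M$ for which there is a finite $F\subset G$ with $\bigl(\bigcap_{f\in F}f\mathbf u\bigr)^2\subset\mathbf u$; it generates a uniformity, namely the filter generated by $\{g\mathbf u:g\in G\}$. A divider is perspective if for every pair $\beta$ of points of $M$ the set $\{g\in G:g\beta\notin\mathbf u\}$ is finite. A uniformity $\mathcal U$ on a connected $G$-set $M$ is relatively hyperbolic if it is generated by a perspective divider and the boundary $\overline M\setminus\iota(M)$ ($\iota:M\to\overline M$ the map to the completion) has at least two points. *)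

(* Defs.v *)
From Stdlib Require Relation_Operators.
From HB Require Import structures.
From mathcomp Require Import all_boot finmap.
From mathcomp Require Import all_classical.
From mathcomp Require Import topology_theory.topology.

Set Implicit Arguments.
Unset Strict Implicit.
Unset Printing Implicit Defensive.

Local Open Scope classical_set_scope.
Local Open Scope card_scope.

Record gaction (G : groupType) (M : Type) := GAction {
  act :> G -> M -> M;
  act1 : forall x, act 1%g x = x;
  actM : forall g h x, act (g * h)%g x = act g (act h x) }.

(* Actions by homeomorphisms: each [act g] has the inverse [act g^-1]. *)
Record hgaction (G : groupType) (X : topologicalType) := HGAction {
  hact :> gaction G X;
  hact_continuous : forall g, continuous (hact g) }.

(* The Vietoris topology is put on all subsets of X, its subbase being the sets
   {A | A `<=` U} and {A | A meets U} for U open. The space of closed subsets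
   and the spaces of n-element subsets are subspaces of it; compactness and
   closure below only depend on the subspace topology. *)
Definition vietoris (X : topologicalType) : Type := set X.

HB.instance Definition _ (X : topologicalType) :=
  Choice.copy (vietoris X) (set X).

Definition vietoris_subbase (X : topologicalType) (i : bool * set X) :
    set (vietoris X) :=
  if i.1 then [set A : set X | A `<=` i.2] else [set A : set X | A `&` i.2 !=set0].

HB.instance Definition _ (X : topologicalType) :=
  @isSubBaseTopological.Build (vietoris X) (bool * set X)%type
    [set i | open i.2] (@vietoris_subbase X).

Lemma vietoris_subbase_open (X : topologicalType) (i : bool * set X) :
  open i.2 -> open (vietoris_subbase i).
Proof.
move=> oi; exists [set vietoris_subbase i]; last by rewrite bigcup_set1.
by move=> _ ->; exact: finI_from1.
Qed.

Lemma vietoris_nbhsP (X : topologicalType) (A : vietoris X)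
    (W : set (vietoris X)) : nbhs A W ->
  exists D : {fset bool * set X}, [/\ forall i, i \in D -> open i.2,
    forall i, i \in D -> vietoris_subbase i A
    & \bigcap_(i in [set` D]) vietoris_subbase i `<=` W].
Proof.
rewrite nbhsE => -[O [[I sI <-] [B IB BA]] sOW].
have [D sD DB] := sI _ IB; exists D; split.
- by move=> i /sD /set_mem.
- by move=> i iD; have: B A := BA; rewrite -DB; exact.
- by move=> A' hA'; apply: sOW; exists B => //; rewrite -DB.
Qed.

Lemma vietoris_image_continuous (Y Z : topologicalType) (f : Y -> Z) :
  continuous f -> continuous (fun A : vietoris Y => (f @` A) : vietoris Z).
Proof.
move=> cf A W /vietoris_nbhsP[D [oD DA DW]].
have FA : Filter (nbhs (A : vietoris Y)) by exact: nbhs_filter.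
suff : nbhs (A : vietoris Y) [set A' | (\bigcap_(i in [set` D]) vietoris_subbase i)
    (f @` A' : vietoris Z)] by apply: filterS => A'; exact: DW.
apply: (@filter_bigI _ _ D
  (fun i => [set A' : vietoris Y | vietoris_subbase i (f @` A')]) _ FA).
move=> i iD; have oi := oD _ iD.
have of' : open (f @^-1` i.2) by apply: open_comp => // y _; exact: cf.
have subE A' : vietoris_subbase i (f @` A') <->
    vietoris_subbase (i.1, f @^-1` i.2) A'.
  rewrite /vietoris_subbase; case: i.1 => /=; split.
  - by move=> h y Ay; apply: h; exists y.
  - by move=> h _ [y Ay <-]; exact: h.
  - by case=> _ [[y Ay <-] ?]; exists y.
  - by case=> y [Ay ?]; exists (f y); split => //; exists y.
have : nbhs (A : vietoris Y) (vietoris_subbase (i.1, f @^-1` i.2)).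
  apply: open_nbhs_nbhs; split; first exact: vietoris_subbase_open.
  by apply/subE; exact: DA.
by apply: filterS => A' /subE.
Qed.

(* The space of n-element subsets. For X Hausdorff the Vietoris topology
   coincides here with the quotient topology from ordered n-tuples. *)
Definition Theta (n : nat) (X : topologicalType) : set (vietoris X) :=
  [set A : set X | A #= `I_n].
Arguments Theta n X : clear implicits.

Section actions.
Variables (G : groupType) (X : topologicalType) (a : hgaction G X).

Definition set_act (g : G) (A : vietoris X) : vietoris X := a g @` A.

Definition proper_on_triples : Prop :=
  forall K : set (vietoris X), K `<=` Theta 3 X -> compact K ->
    finite_set [set g : G | (set_act g @` K) `&` K !=set0].

Definition cocompact_on_pairs : Prop :=
  exists2 K : set (vietoris X), K `<=` Theta 2 X /\ compact K &
    \bigcup_(g in [set: G]) (set_act g @` K) = Theta 2 X.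

Definition graph_of (g : G) : vietoris (X * X)%type := [set p | p.2 = a g p.1].

Definition cross (r t : X) : vietoris (X * X)%type :=
  [set p | p.1 = r \/ p.2 = t].

Definition bd (S : set G) : set (X * X) :=
  [set p | closure (graph_of @` S) (cross p.1 p.2)].

Definition bd0 (S : set G) : set X := fst @` bd S.
Definition bd1 (S : set G) : set X := snd @` bd S.

Definition limit_point : set X := bd1 [set: G].

Definition cone (S : set G) : Prop :=
  infinite_set S /\
  bd1 S `&` closure [set a g x | g in S & x in bd0 S] = set0.

Definition conical : set X :=
  [set p | exists2 S : set G, cone S & bd0 S = [set p]].

Definition nonconical : set X := ~` conical.

Definition RH32 : Prop :=
  [/\ proper_on_triples, cocompact_on_pairs
    & exists p q, [/\ limit_point p, limit_point q & p <> q]].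

End actions.

(* A cone S with vertex p yields the cone S g^-1 with vertex g p, so the set of
   non-conical points is invariant. *)
Section invariance.
Variables (G : groupType) (X : topologicalType) (a : hgaction G X).

Let tw (h : G) (p : X * X) : X * X := (a h p.1, p.2).

Lemma bd_shift (h : G) (S : set G) (p : X * X) :
  bd a S p -> bd a [set (s * h^-1)%g | s in S] (tw h p).
Proof.
move=> clp W Wtw.
have ctw : continuous (tw h).
  move=> q; apply: (@cvg_pair _ _ _ _ (nbhs (a h q.1)) (nbhs q.2)); last first.
    exact: cvg_snd.
  by apply: (cvg_comp fst (a h)); [exact: cvg_fst | exact: hact_continuous].
have twK (q : X * X) : tw h (a h^-1%g q.1, q.2) = q.
  by rewrite /tw /= -actM mulgV act1 -surjective_pairing.
have crossE : tw h @` cross p.1 p.2 = cross (tw h p).1 (tw h p).2.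
  apply/seteqP; split => [_ [q + <-]|q].
    by rewrite /cross /=; move=> [] ->; [left | right].
  move=> qc; exists (a h^-1%g q.1, q.2); last exact: twK.
  by case: qc => /= qc; [left | right]; rewrite /= qc // -actM mulVg act1.
have := @vietoris_image_continuous _ _ _ ctw (cross p.1 p.2) W.
rewrite crossE => /(_ Wtw) /clp [_ [[s Ss <-] Ws]].
exists (graph_of a (s * h^-1)%g); split; first by exists (s * h^-1)%g => //; exists s.
suff <- : tw h @` graph_of a s = graph_of a (s * h^-1)%g by [].
apply/seteqP; split => [_ [q + <-]|q].
  by rewrite /graph_of /= => ->; rewrite -actM mulgVK.
move=> qg; exists (a h^-1%g q.1, q.2); last exact: twK.
by rewrite /graph_of /= -actM.
Qed.

Lemma shiftK (h : G) (S : set G) :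
  [set (s * h^-1^-1)%g | s in [set (s * h^-1)%g | s in S]] = S.
Proof.
rewrite invgK; apply/seteqP; split => [_ [_ [s Ss <-] <-]|s Ss].
  by rewrite mulgVK.
by exists (s * h^-1)%g; [exists s | rewrite mulgVK].
Qed.

Lemma bd_shiftE (h : G) (S : set G) :
  bd a [set (s * h^-1)%g | s in S] = tw h @` bd a S.
Proof.
apply/seteqP; split => [p /(@bd_shift h^-1%g _ _)|_ [p Sp <-]]; last exact: bd_shift.
rewrite shiftK => Sp; exists (tw h^-1%g p) => //.
by rewrite /tw /= -actM mulgV act1 -surjective_pairing.
Qed.

Lemma bd0_shift (h : G) (S : set G) :
  bd0 a [set (s * h^-1)%g | s in S] = a h @` bd0 a S.
Proof. by rewrite /bd0 bd_shiftE !image_comp. Qed.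

Lemma bd1_shift (h : G) (S : set G) :
  bd1 a [set (s * h^-1)%g | s in S] = bd1 a S.
Proof. by rewrite /bd1 bd_shiftE image_comp. Qed.

Lemma cone_shift (h : G) (S : set G) :
  cone a S -> cone a [set (s * h^-1)%g | s in S].
Proof.
move=> [infS dS]; split.
  move=> fS; apply: infS; rewrite -(shiftK h S); exact: finite_image.
rewrite bd1_shift bd0_shift; suff -> :
    [set a g x | g in [set (s * h^-1)%g | s in S] & x in a h @` bd0 a S]
    = [set a g x | g in S & x in bd0 a S] by [].
apply/seteqP; split => [_ [_ [s Ss <-] [_ [x Sx <-] <-]]|_ [s Ss [x Sx <-]]].
  by exists s => //; exists x => //; rewrite -actM mulgVK.
exists (s * h^-1)%g; first by exists s.
by exists (a h x); [exists x | rewrite -actM mulgVK].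
Qed.

Lemma conical_invariant (h : G) (x : X) : conical a x -> conical a (a h x).
Proof.
move=> [S cS Sx]; exists [set (s * h^-1)%g | s in S]; first exact: cone_shift.
by rewrite bd0_shift Sx image_set1.
Qed.

Lemma nonconical_invariant (h : G) (x : X) :
  nonconical a x -> nonconical a (a h x).
Proof.
move=> nx /(@conical_invariant h^-1%g _).
by rewrite -actM mulVg act1.
Qed.

Definition nonconical_act (g : G) (x : nonconical a) : nonconical a :=
  SigSub (mem_set (@nonconical_invariant g _ (set_valP x))).

Lemma nonconical_act1 (x : nonconical a) : nonconical_act 1%g x = x.
Proof. by apply: val_inj; rewrite /= act1. Qed.

Lemma nonconical_actM (g h : G) (x : nonconical a) :
  nonconical_act (g * h)%g x = nonconical_act g (nonconical_act h x).
Proof. by apply: val_inj; rewrite /= actM. Qed.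

Definition nonconical_gset : gaction G (nonconical a) :=
  GAction nonconical_act1 nonconical_actM.

End invariance.

(* The space X, equipped with the action b, is the attractor sum: X is identified
   with the disjoint union of G and T by j, and G acts on itself by left
   multiplication. [wopen f] is the topology induced by f. *)
Record attractor_sum (G : groupType) (T : topologicalType) (a : hgaction G T)
    (X : topologicalType) (b : hgaction G X) (j : G + T -> X) : Prop := {
  asum_bij : bijective j;
  asum_actG : forall g h, b g (j (inl h)) = j (inl (g * h)%g);
  asum_actT : forall g t, b g (j (inr t)) = j (inr (a g t));
  asum_compact : compact [set: X];
  asum_hausdorff : hausdorff_space X;
  asum_openG : wopen (fun g : G => j (inl g)) = [set: set G];
  asum_openT : wopen (fun t : T => j (inr t)) = @open T;
  asum_proper : proper_on_triples b }.

Definition S2 (M : Type) := {A : set M | exists x y, A = [set x; y]}.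

Definition upair (M : Type) (x y : M) : S2 M :=
  exist _ [set x; y] (ex_intro _ x (ex_intro _ y erefl)).

Lemma S2map_subproof (M N : Type) (f : M -> N) (p : S2 M) :
  exists x y, f @` sval p = [set x; y].
Proof.
by case: p => _ /= [x [y ->]]; exists (f x), (f y); rewrite image_setU !image_set1.
Qed.

Definition S2map (M N : Type) (f : M -> N) (p : S2 M) : S2 N :=
  exist _ (f @` sval p) (S2map_subproof f p).

Definition diag2 (M : Type) : set (S2 M) := [set upair x x | x in [set: M]].
Arguments diag2 M : clear implicits.

Definition sq2 (M : Type) (u : set (S2 M)) : set (S2 M) :=
  [set p | exists x y z, [/\ p = upair x y, u (upair x z) & u (upair z y)]].

Definition uniformity (M : Type) (U : set_system (S2 M)) : Prop :=
  [/\ Filter U, forall u, U u -> diag2 M `<=` u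
    & forall u, U u -> exists2 v, U v & sq2 v `<=` u].

(* S2 X carries the quotient topology of X * X, in which the neighborhoods of
   the diagonal are the sets whose preimage is a neighborhood of the diagonal
   of X * X. *)
Definition compact_unif (X : topologicalType) : set_system (S2 X) :=
  [set u | forall x : X, \forall p \near (x, x), u (upair p.1 p.2)].
Arguments compact_unif X : clear implicits.

Definition induced_unif (X : Type) (A : set X) (U : set_system (S2 X)) :
    set_system (S2 A) :=
  filter_from U (fun u => S2map (fun x : A => val x) @^-1` u).

(* The Hausdorff completion of M, whose points are the minimal Cauchy filters;
   the map from M sends x to the filter of its neighborhoods. *)
Section completion.
Variables (M : Type) (U : set_system (S2 M)).

Definition cauchy_filter (F : set_system M) : Prop :=
  ProperFilter F /\
  forall u, U u -> exists2 A, F A & forall x y, A x -> A y -> u (upair x y).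

Definition completion : set (set_system M) :=
  [set F | cauchy_filter F /\
           forall F', cauchy_filter F' -> F' `<=` F -> F' = F].

Definition completion_map (x : M) : set_system M :=
  filter_from U (fun u => [set y | u (upair x y)]).

Definition boundary : set (set_system M) :=
  completion `\` range completion_map.

End completion.

Section gsets.
Variables (G : groupType) (M : Type) (a : gaction G M).

(* A graph is given by its edges E and their endpoints; multiple edges and loops
   are allowed. *)
Definition connected_gset : Prop :=
  exists (E : Type) (ends : E -> S2 M) (b : gaction G E),
    [/\ forall g e, ends (b g e) = S2map (a g) (ends e),
        forall x y, Relation_Operators.clos_refl_trans M
          (fun x y => exists e, ends e = upair x y) x y
      & exists2 F : set E, finite_set F & \bigcup_(g in [set: G]) (b g @` F) = setT].

Definition divider (u : set (S2 M)) : Prop :=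
  diag2 M `<=` u /\
  exists2 F : set G, finite_set F &
    sq2 (\bigcap_(f in F) (S2map (a f) @` u)) `<=` u.

Definition generated_unif (u : set (S2 M)) : set_system (S2 M) :=
  smallest Filter [set S2map (a g) @` u | g in [set: G]].

Definition perspective (u : set (S2 M)) : Prop :=
  forall p : S2 M, finite_set [set g | ~ u (S2map (a g) p)].

Definition relatively_hyperbolic (U : set_system (S2 M)) : Prop :=
  [/\ uniformity U, connected_gset,
      exists u, [/\ divider u, perspective u & U = generated_unif u]
    & exists F F', [/\ boundary U F, boundary U F' & F <> F']].

End gsets.

(* Main.v *)
Require Import Defs.
From mathcomp Require Import all_boot finmap.
From mathcomp Require Import all_classical.
From mathcomp Require Import topology_theory.topology.

(** The action on the attractor sum [X] is expansive: cocompactness on pairs gives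
    a closed entourage [u] of [X] such that any two distinct points are taken out
    of [u] by an element of [G] (lemma [expansive_entourage]). The translates of
    [u] thus intersect in the diagonal, and compactness of [X] turns this into two
    finite statements: [u] is a divider, and its translates generate the uniformity
    of [X]. Both restrict to any invariant subset, in particular to the set [M] of
    non-conical points ([expansive_divider], [expansive_generated]).

    Perspectivity is where the choice of [M] matters. Properness on triples implies
    the convergence property: along a nonprincipal ultrafilter on [G] the graphs
    converge to a cross ([graphs_cvg_cross]), that is, all points but one are
    attracted to a common point. So if infinitely many [g] keep the images of [x]
    and [y] apart, then one of the two, say [x], is the exceptional point, and such
    [g] separate [x] from all other points; a cone with vertex [x] results
    ([conical_of_separation], [nonconical_perspective]).

    The boundary of [M] contains the conical points. They are in the closure of
    [G], which consists of non-conical points because the vertex of a cone is never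
    isolated ([conical_closure]), and each gives a minimal Cauchy filter on [M]
    that does not come from a point of [M] ([trace_boundary]). There are at least
    two of them: two limit points provide, by composing elements if necessary, an
    element [g] that maps the complement of a closed set [U] into a closed set [V]
    disjoint from [U] ([limit_points_push]). A point of [U] whose forward orbit
    remains in [U] is then separated by the powers of [g] from a point that enters
    [V], so it is conical; the inverse of [g] provides a conical point in [V]
    ([two_conical_points]). *)

Set Implicit Arguments.
Unset Strict Implicit.
Unset Printing Implicit Defensive.

Local Open Scope classical_set_scope.
Local Open Scope card_scope.

(** * Compact Hausdorff spaces *)

(** If no finite subfamily covered [K], the sets left uncovered by finite
    subfamilies would generate a proper filter on [K]; a cluster point of it has
    no [f i] as a neighborhood. *)
Lemma compact_finite_cover (X : topologicalType) (I : Type) (K : set X)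
    (A : set I) (f : I -> set X) :
  compact K -> (forall x, K x -> exists2 i, A i & nbhs x (f i)) ->
  exists F : set I, [/\ finite_set F, F `<=` A & K `<=` \bigcup_(i in F) f i].
Proof.
move=> cK fK; apply: contrapT => noF.
pose B := [set F : set I | finite_set F /\ F `<=` A].
pose FF := filter_from B (fun F => K `\` \bigcup_(i in F) f i).
have PF : ProperFilter FF.
  apply: filter_from_proper.
    apply: filter_from_filter; first by exists set0; split.
    move=> F1 F2 [fF1 sF1] [fF2 sF2]; exists (F1 `|` F2).
      by split; [rewrite finite_setU | move=> i []; [exact: sF1 | exact: sF2]].
    rewrite bigcup_setU => x [Kx nx].
    by split; split => // h; apply: nx; [left | right].
  move=> F [fF sF]; apply/set0P/negP => /eqP; rewrite setD_eq0 => KF.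
  by apply: noF; exists F.
have FK : FF K.
  by exists set0; [split | exact: subDsetl].
have [x [Kx clx]] := cK FF PF FK.
have [i Ai fi] := fK x Kx.
have [y [[Ky ny] fy]] : (K `\` \bigcup_(k in [set i]) f k) `&` f i !=set0.
  by apply: clx => //; exists [set i] => //; split => // _ ->.
by apply: ny; exists i.
Qed.

Lemma compact_bigcap_sub (X : topologicalType) (I : Type) (A : set I)
    (D : I -> set X) (O : set X) :
  compact [set: X] -> (forall i, A i -> closed (D i)) -> open O ->
  \bigcap_(i in A) D i `<=` O ->
  exists F : set I, [/\ finite_set F, F `<=` A & \bigcap_(i in F) D i `<=` O].
Proof.
move=> cX cD oO sO.
have cK : compact (~` O).
  by apply: (subclosed_compact _ cX) => //; exact: open_closedC.
have [|F [fF FA FO]] := @compact_finite_cover _ _ _ A (fun i => ~` D i) cK.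
  move=> x Ox; apply: contrapT => /forall2NP h; apply: Ox; apply: sO => i Ai.
  apply: contrapT => nD; have [//|] := h i; apply.
  by apply: open_nbhs_nbhs; split => //; exact: closed_openC (cD i Ai).
exists F; split => // x Dx; apply: contrapT => /FO [i Fi]; apply; exact: Dx.
Qed.

Section compactum.
Variables (X : topologicalType).
Hypotheses (cX : compact [set: X]) (hX : hausdorff_space X).

Lemma closed_nbhs_sub (x : X) (N : set X) :
  nbhs x N -> exists V : set X, [/\ closed V, nbhs x V & V `<=` N].
Proof.
move=> xN; have [|V xV VN] := @compact_regular X x setT hX cX _ N xN.
  exact: filterT.
exists (closure V); split => //; first exact: closed_closure.
by apply: filterS xV; exact: subset_closure.
Qed.

Lemma compactum_separate (x y : X) : x <> y -> exists U V : set X,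
  [/\ closed U, closed V, nbhs x U, nbhs y V & U `&` V = set0].
Proof.
move=> /eqP xy; have := hX; rewrite open_hausdorff => /(_ _ _ xy).
move=> [[U V] /= [xU yV] [oU oV UV0]]; rewrite !inE in xU yV.
have [U' [cU' xU' sU]] := closed_nbhs_sub (open_nbhs_nbhs (conj oU xU)).
have [V' [cV' yV' sV]] := closed_nbhs_sub (open_nbhs_nbhs (conj oV yV)).
exists U', V'; split => //; apply/seteqP; split => // z [/sU Uz /sV Vz].
by rewrite -(eqP UV0).
Qed.

Lemma compactum_open_set1C (x : X) : open (~` [set x]).
Proof.
apply: closed_openC; apply: compact_closed => //; exact: compact_set1.
Qed.

End compactum.

(** * Unordered pairs and uniformities *)

Section unordered_pairs.
Variable M : Type.

Lemma S2_inj (p q : S2 M) : sval p = sval q -> p = q.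
Proof. by case: p q => [A hA] [B hB] /= AB; subst B; congr exist; exact: Prop_irrelevance. Qed.

Lemma S2P (p : S2 M) : exists x y, p = upair x y.
Proof. by case: (p) => A [x [y Axy]]; exists x, y; apply: S2_inj. Qed.

Lemma upairC (x y : M) : upair x y = upair y x.
Proof. by apply: S2_inj; rewrite /= setUC. Qed.

Lemma upair_inj (x y x' y' : M) : upair x y = upair x' y' ->
  x = x' /\ y = y' \/ x = y' /\ y = x'.
Proof.
move=> /(congr1 sval) /= E.
have Ex : [set x'; y'] x by rewrite -E; left.
have Ey : [set x'; y'] y by rewrite -E; right.
have Ex' : [set x; y] x' by rewrite E; left.
have Ey' : [set x; y] y' by rewrite E; right.
by case: Ex; case: Ey; case: Ex'; case: Ey' => /= *;
  (left; split; congruence) || (right; split; congruence).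
Qed.

End unordered_pairs.

Lemma S2map_upair (M N : Type) (f : M -> N) (x y : M) :
  S2map f (upair x y) = upair (f x) (f y).
Proof. by apply: S2_inj; rewrite /= image_setU !image_set1. Qed.

Lemma S2map_comp (M N L : Type) (f : N -> L) (g : M -> N) (p : S2 M) :
  S2map f (S2map g p) = S2map (fun x => f (g x)) p.
Proof. by apply: S2_inj; rewrite /= image_comp. Qed.

Lemma S2map_id_eq (M : Type) (f : M -> M) (p : S2 M) :
  f =1 id -> S2map f p = p.
Proof.
by move=> fE; apply: S2_inj => /=; have -> : f = id; [exact/funext | rewrite image_id].
Qed.

Lemma S2map_act_image (G : groupType) (M : Type) (a : gaction G M) (g : G)
    (u : set (S2 M)) :
  S2map (a g) @` u = S2map (a g^-1%g) @^-1` u.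
Proof.
apply/seteqP; split => [_ [p up <-]|p up].
  by rewrite /preimage /= S2map_comp S2map_id_eq // => x; rewrite -actM mulVg act1.
exists (S2map (a g^-1%g) p) => //.
by rewrite S2map_comp S2map_id_eq // => x; rewrite -actM mulgV act1.
Qed.

(** Closedness in the quotient topology of [S2 X]. *)
Definition pair_closed (X : topologicalType) (u : set (S2 X)) :=
  closed [set p : X * X | u (upair p.1 p.2)].

Lemma sq2_upair (M : Type) (u : set (S2 M)) (x y z : M) :
  u (upair x z) -> u (upair z y) -> sq2 u (upair x y).
Proof. by move=> *; exists x, y, z. Qed.

(** Compactness of [X * X * X]: the closed sets of triples [(x, z, y)] with
    [{x, z}] and [{z, y}] in [v i] intersect within the diagonal, hence in
    the open set of triples whose end points are [w]-close. *)
Lemma compact_sq2_sub (X : topologicalType) (I : Type) (A : set I)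
    (v : I -> set (S2 X)) (w : set (S2 X)) :
  compact [set: X] -> (forall i, A i -> pair_closed (v i)) ->
  \bigcap_(i in A) v i `<=` diag2 X -> compact_unif X w ->
  exists F : set I, [/\ finite_set F, F `<=` A & sq2 (\bigcap_(i in F) v i) `<=` w].
Proof.
move=> cX cv vD Uw.
pose pw := [set p : X * X | w (upair p.1 p.2)].
pose D i := [set t : X * X * X | v i (upair t.1.1 t.1.2) /\ v i (upair t.1.2 t.2)].
pose O := (fun t : X * X * X => (t.1.1, t.2)) @^-1` (interior pw).
have c2 : compact [set: X * X * X].
  by rewrite -setXTT -setXTT; apply: compact_setX => //; apply: compact_setX.
have c23 : continuous (fun t : X * X * X => (t.1.2, t.2)).
  move=> t; apply: (@cvg_pair _ _ _ _ (nbhs t.1.2) (nbhs t.2)); last exact: cvg_snd.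
  by apply: (cvg_comp fst snd); [exact: cvg_fst | exact: cvg_snd].
have c13 : continuous (fun t : X * X * X => (t.1.1, t.2)).
  move=> t; apply: (@cvg_pair _ _ _ _ (nbhs t.1.1) (nbhs t.2)); last exact: cvg_snd.
  by apply: (cvg_comp fst fst); [exact: cvg_fst | exact: cvg_fst].
have [||| F [fF FA FO]] := @compact_bigcap_sub _ _ A D O c2.
- move=> i Ai; have cvi := cv i Ai.
  have -> : D i = (fst @^-1` [set p : X * X | v i (upair p.1 p.2)]) `&`
      ((fun t : X * X * X => (t.1.2, t.2)) @^-1` [set p : X * X | v i (upair p.1 p.2)]).
    by [].
  by apply: closedI; apply: preimage_closed => // t _; exact: cvg_fst.
- by apply: open_comp; [move=> t _; exact: c13 | exact: open_interior].
- move=> [[x z] y] h.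
  have diagE (p q : X) : (\bigcap_(i in A) v i) (upair p q) -> p = q.
    by move=> /vD [s _ e]; case: (upair_inj e) => -[<- <-].
  have <- : x = z by apply: diagE => i Ai; have [] := h i Ai.
  have <- : x = y.
    rewrite (@diagE x z); first by apply: diagE => i Ai; have [] := h i Ai.
    by move=> i Ai; have [] := h i Ai.
  exact: Uw x.
exists F; split => // _ [x [y [z [-> xz zy]]]].
have /interior_subset : O (x, z, y).
  by apply: FO => i Fi; split; [exact: xz | exact: zy].
by [].
Qed.

Lemma sub_sq2 (M : Type) (u : set (S2 M)) : diag2 M `<=` u -> u `<=` sq2 u.
Proof.
move=> du p up; have [x [y pE]] := S2P p; exists x, y, y; split => //.
  by rewrite -pE.
by apply: du; exists y.
Qed.

Lemma compact_unif_diag (X : topologicalType) (u : set (S2 X)) :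
  compact_unif X u -> diag2 X `<=` u.
Proof. by move=> Uu _ [x _ <-]; exact: (nbhs_singleton (Uu x)). Qed.

Lemma compact_unif_filter (X : topologicalType) : Filter (compact_unif X).
Proof.
split.
- by move=> x; apply: filterT.
- by move=> u v Uu Uv x; apply: filterI (Uu x) (Uv x).
- by move=> u v uv Uu x; apply: filterS (Uu x) => p; exact: uv.
Qed.

(** For disjoint [i.1] and [i.2] these are the pairs with one point in each; the
    complements of such sets are the elementary entourages used below. *)
Definition apart (X : Type) (i : set X * set X) : set (S2 X) :=
  [set p | sval p `&` i.1 !=set0 /\ sval p `&` i.2 !=set0].

Lemma apart_upair (X : Type) (U V : set X) (x y : X) :
  apart (U, V) (upair x y) <-> (U x \/ U y) /\ (V x \/ V y).
Proof.
split=> [[[s [+ Us]] [t [+ Vt]]]|[xU xV]].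
  by case=> /= e1; case=> /= e2; subst; split; auto.
split.
  by case: xU => [Ux|Uy]; [exists x; split => //; left | exists y; split => //; right].
by case: xV => [Ux|Uy]; [exists x; split => //; left | exists y; split => //; right].
Qed.

(** Openness makes the complement of [apart i] closed, and disjointness of the
    closures makes it a neighborhood of the diagonal. *)
Definition closure_disjoint (X : topologicalType) : set (set X * set X) :=
  [set i | [/\ open i.1, open i.2 & closure i.1 `&` closure i.2 = set0]].

Lemma apartC_closed (X : topologicalType) (i : set X * set X) :
  closure_disjoint i -> pair_closed (~` apart i).
Proof.
case: i => U V [/= oU oV _]; rewrite /pair_closed.
have -> : [set p : X * X | (~` apart (U, V)) (upair p.1 p.2)] =
    ~` ((fst @^-1` U `|` snd @^-1` U) `&` (fst @^-1` V `|` snd @^-1` V)).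
  apply/seteqP; split => p h h'; apply: h.
    apply/apart_upair; exact: h'.
  by move/apart_upair: h'.
apply: open_closedC.
have of_ W : open W -> open (@fst X X @^-1` W).
  by move=> oW; apply: open_comp => // p _; exact: cvg_fst.
have os_ W : open W -> open (@snd X X @^-1` W).
  by move=> oW; apply: open_comp => // p _; exact: cvg_snd.
by apply: openI; apply: openU; by [exact: of_ | exact: os_].
Qed.

Lemma apartC_unif (X : topologicalType) (i : set X * set X) :
  closure_disjoint i -> compact_unif X (~` apart i).
Proof.
case: i => U V [/= oU oV UV0] x.
have [W [xW hW]] : exists W, nbhs x W /\ (W `<=` ~` U \/ W `<=` ~` V).
  have [xU|xU] := pselect (closure U x); last first.
    exists (~` closure U); split.
      by apply: open_nbhs_nbhs; split => //; exact: closed_openC (@closed_closure _ U).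
    by left => z Wz Uz; apply: Wz; exact: subset_closure.
  exists (~` closure V); split.
    apply: open_nbhs_nbhs; split; first exact: closed_openC (@closed_closure _ V).
    by move=> xV; have : (closure U `&` closure V) x by []; rewrite UV0.
  by right => z Wz Uz; apply: Wz; exact: subset_closure.
exists (W, W) => // -[p q] [/= Wp Wq] /apart_upair [hU hV].
case: hW => sW; first by case: hU; exact: sW.
by case: hV; exact: sW.
Qed.

Lemma filter_bigcap (T I : Type) (F : set_system T) (A : set I) (v : I -> set T) :
  Filter F -> finite_set A -> (forall i, A i -> F (v i)) -> F (\bigcap_(i in A) v i).
Proof.
move=> FF; elim/Pchoice : I => I in A v * => /finite_fsetP[D ->] h.
exact: filter_bigI.
Qed.

Lemma separated_pair (X : topologicalType) (x y : X) :
  compact [set: X] -> hausdorff_space X -> x <> y ->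
  exists i, [/\ closure_disjoint i, i.1 x & i.2 y].
Proof.
move=> cX hX /(compactum_separate cX hX) [U [V [cU cV xU yV UV0]]].
exists (interior U, interior V); split => //=.
split; [exact: open_interior | exact: open_interior |].
apply/seteqP; split => // z [/(closureS (@interior_subset _ U)) Uz].
move=> /(closureS (@interior_subset _ V)) Vz.
by rewrite -UV0; split; [exact: cU | exact: cV].
Qed.

(** The elementary entourages intersect in the diagonal, so any given entourage
    contains the square of a finite intersection of them. *)
Lemma compact_unif_uniformity (X : topologicalType) :
  compact [set: X] -> hausdorff_space X -> uniformity (compact_unif X).
Proof.
move=> cX hX; split; first exact: compact_unif_filter.
  exact: compact_unif_diag.
move=> w Uw.
have [| | F [fF sF Fw]] :=
    @compact_sq2_sub X _ (@closure_disjoint X) (fun i => ~` apart i) w cX _ _ Uw.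
- by move=> i; exact: apartC_closed.
- move=> p; have [x [y ->]] := S2P p => h.
  have [-> |] := pselect (x = y); first by exists y.
  move=> /(separated_pair cX hX) [[U V] [sUV Ux Vy]].
  by have [] := h _ sUV; apply/apart_upair; split; [left | right].
- exists (\bigcap_(i in F) ~` apart i) => //.
  apply: filter_bigcap => // [|i /sF]; first exact: compact_unif_filter.
  exact: apartC_unif.
Qed.

Lemma induced_uniformity (X : Type) (A : set X) (U : set_system (S2 X)) :
  uniformity U -> uniformity (induced_unif (A := A) U).
Proof.
move=> [FU dU sU]; split.
- apply: filter_from_filter; first by exists setT; exact: filterT.
  by move=> u v Uu Uv; exists (u `&` v) => //; exact: filterI.
- move=> v [u Uu uv] _ [x _ <-]; apply: uv.
  by rewrite /preimage /= S2map_upair; apply: dU Uu _ _; exists (val x).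
- move=> v [u Uu uv]; have [w Uw wu] := sU u Uu.
  exists (S2map (fun x : A => val x) @^-1` w); first by exists w.
  move=> _ [x [y [z [-> xz zy]]]]; apply: uv; apply: wu.
  rewrite /preimage /= !S2map_upair in xz zy *.
  exact: sq2_upair xz zy.
Qed.

(** * Expansive entourages *)

Section translates.
Variables (G : groupType) (X : topologicalType) (b : hgaction G X).

Lemma act_pair_continuous (g : G) :
  continuous (fun p : X * X => (b g p.1, b g p.2)).
Proof.
move=> p; apply: (@cvg_pair _ _ _ _ (nbhs (b g p.1)) (nbhs (b g p.2))).
  by apply: (cvg_comp fst (b g)); [exact: cvg_fst | exact: hact_continuous].
by apply: (cvg_comp snd (b g)); [exact: cvg_snd | exact: hact_continuous].
Qed.

Lemma compact_unif_translate (g : G) (u : set (S2 X)) :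
  compact_unif X u -> compact_unif X (S2map (b g) @^-1` u).
Proof.
move=> Uu x; have := @act_pair_continuous g (x, x) _ (Uu (b g x)).
apply: (@filterS _ (nbhs (x, x))) => p.
by rewrite /preimage /= S2map_upair.
Qed.

Lemma pair_closed_translate (g : G) (u : set (S2 X)) :
  pair_closed u -> pair_closed (S2map (b g) @^-1` u).
Proof.
move=> cu; rewrite /pair_closed.
have -> : [set p : X * X | (S2map (b g) @^-1` u) (upair p.1 p.2)] =
    (fun p : X * X => (b g p.1, b g p.2)) @^-1` [set p | u (upair p.1 p.2)].
  by apply/seteqP; split => p; rewrite /preimage /= S2map_upair.
by apply: preimage_closed => // p _; exact: act_pair_continuous.
Qed.

End translates.

(** The restriction of an expansive action on a compact space [X] to an invariant
    set [A]. Expansiveness [expu] says that the translates of the closed entourage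
    [u] intersect in the diagonal. *)
Section expansive.
Variables (G : groupType) (X : topologicalType) (b : hgaction G X).
Variables (A : set X) (c : gaction G A) (u : set (S2 X)).
Hypotheses (cX : compact [set: X]).
Hypothesis (cE : forall g x, val (c g x) = b g (val x)).
Hypotheses (Uu : compact_unif X u) (cu : pair_closed u).
Hypothesis (expu : forall x y, x <> y -> exists g, ~ u (upair (b g x) (b g y))).

Let uA := S2map (fun x : A => val x) @^-1` u.

Lemma translate_restriction (g : G) :
  S2map (c g) @` uA = S2map (fun x : A => val x) @^-1` (S2map (b g^-1%g) @^-1` u).
Proof.
rewrite S2map_act_image; apply/seteqP; split => p; have [x [y ->]] := S2P p;
  by rewrite /uA /preimage /= !S2map_upair !cE.
Qed.

(** The translates of [u] are closed and intersect in the diagonal, so compactness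
    provides [F]. For [w := u] this is the divider property; for any [w] it shows
    that the translates of [u] generate the uniformity. *)
Lemma expansive_finite_sq2 (w : set (S2 X)) : compact_unif X w ->
  exists F : set G, finite_set F /\
    sq2 (\bigcap_(f in F) (S2map (b f^-1%g) @^-1` u)) `<=` w.
Proof.
move=> Uw.
have [g _||F [fF _ Fw]] := @compact_sq2_sub X G setT
    (fun f => S2map (b f^-1%g) @^-1` u) w cX _ _ Uw.
- exact: pair_closed_translate.
- move=> p; have [x [y ->]] := S2P p => h.
  have [-> |/expu[g ng]] := pselect (x = y); first by exists y.
  have := h g^-1%g I; rewrite /preimage /= S2map_upair.
  by have -> : (g^-1^-1)%g = g by rewrite invgK.
- by exists F.
Qed.

Lemma expansive_divider : divider c uA.
Proof.
split.
  move=> _ [x _ <-]; rewrite /uA /preimage /= S2map_upair.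
  by apply: compact_unif_diag Uu _ _; exists (val x).
have [F [fF Fu]] := expansive_finite_sq2 Uu; exists F => //.
move=> _ [x [y [z [-> xz zy]]]]; rewrite /uA /preimage /= S2map_upair.
apply: Fu; apply: (@sq2_upair _ _ _ _ (val z)) => f Ff.
  by have := xz f Ff; rewrite translate_restriction /preimage /= !S2map_upair.
by have := zy f Ff; rewrite translate_restriction /preimage /= !S2map_upair.
Qed.

Lemma expansive_generated :
  induced_unif (A := A) (compact_unif X) = generated_unif c uA.
Proof.
apply/seteqP; split; last first.
  apply: smallest_sub.
    apply: filter_from_filter; first by exists setT; exact: (@compact_unif_filter X).(filterT).
    move=> v w Uv Uw; exists (v `&` w) => //.
    exact: (@compact_unif_filter X).(filterI).
  move=> _ [g _ <-]; rewrite translate_restriction.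
  by exists (S2map (b g^-1%g) @^-1` u) => //; exact: compact_unif_translate.
move=> v [w Uw wv] H [FH sH].
have [F [fF Fw]] := expansive_finite_sq2 Uw.
have : H (\bigcap_(f in F) (S2map (c f) @` uA)).
  by apply: filter_bigcap => // f _; apply: sH; exists f.
apply: filterS => p hp; apply: wv; apply: Fw; apply: sub_sq2.
  by move=> q dq f _; exact: (compact_unif_diag (@compact_unif_translate _ _ b f^-1%g _ Uu) dq).
by move=> f Ff; have := hp f Ff; rewrite translate_restriction.
Qed.

End expansive.

(** * Sets with few elements *)

Lemma card_set2 (T : choiceType) (x y : T) : x <> y -> [set x; y] #= `I_2.
Proof.
move=> /eqP xy; have -> : [set x; y] = [set` [fset x; y]%fset].
  by apply/seteqP; split => z /=; rewrite !inE; [case=> ->; rewrite eqxx ?orbT|case/orP => /eqP; auto].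
by apply/card_eq_fsetP; rewrite cardfs2 xy.
Qed.

Lemma card_set3 (T : choiceType) (x y z : T) : x <> y -> x <> z -> y <> z ->
  [set x; y; z] #= `I_3.
Proof.
move=> /eqP xy /eqP xz /eqP yz.
have -> : [set x; y; z] = [set` [fset x; y; z]%fset].
  apply/seteqP; split => w /=; rewrite !inE.
    by case=> [[]|] ->; rewrite eqxx ?orbT.
  by case/orP => [/orP[]|] /eqP; auto.
apply/card_eq_fsetP.
by rewrite fsetUC cardfsU1 cardfs2 !inE negb_or eq_sym xz eq_sym yz xy.
Qed.

Lemma card_ge_inj (T : Type) (A : set T) (n : nat) : `I_n.+1 #<= A ->
  exists f : nat -> T, (forall i, (i < n.+1)%N -> A (f i)) /\
    (forall i j, (i < n.+1)%N -> (j < n.+1)%N -> f i = f j -> i = j).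
Proof.
move=> /card_leP[f].
have lt i : `I_n.+1 (@inord n i) by exact: ltn_ord.
pose e i : `I_n.+1 := SigSub (mem_set (lt i)).
exists (fun i => val (f (e i))); split => [i _|i k li lk /val_inj].
  exact: set_valP.
move/(@inj _ _ _ f); rewrite !inE => /(_ I I) /(congr1 val) /=.
by rewrite !inordK.
Qed.

Lemma card_ge2 (T : Type) (A : set T) : `I_2 #<= A ->
  exists x y, [/\ A x, A y & x <> y].
Proof.
move=> /card_ge_inj[f [Af fI]].
by exists (f 0), (f 1); split; [exact: Af | exact: Af | move/fI => /(_ isT isT)].
Qed.

Lemma card_ge3 (T : Type) (A : set T) : `I_3 #<= A ->
  exists x y z, [/\ A x, A y & A z] /\ [/\ x <> y, x <> z & y <> z].
Proof.
move=> /card_ge_inj[f [Af fI]]; exists (f 0), (f 1), (f 2).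
by split; split; try exact: Af; move/fI => /(_ isT isT).
Qed.

(** * The Vietoris topology *)

Lemma vietoris_cvg (I : Type) (F : set_system I) (X : topologicalType)
    (f : I -> vietoris X) (A : vietoris X) : Filter F ->
  (forall U : set X, open U -> A `<=` U -> F [set i | f i `<=` U]) ->
  (forall U : set X, open U -> A `&` U !=set0 -> F [set i | f i `&` U !=set0]) ->
  f @ F --> A.
Proof.
move=> FF hsub hmeet W /vietoris_nbhsP[D [oD DA DW]].
have : F (\bigcap_(i in [set` D]) (f @^-1` (vietoris_subbase i))).
  apply: filter_bigI => -[[] U] iD; have := oD _ iD; have := DA _ iD => /= AU oU.
    exact: hsub oU AU.
  exact: hmeet oU AU.
by apply: (@filterS _ F FF) => i h; apply: DW => k kD; exact: h.
Qed.

Lemma nbhs_vietoris_sub (X : topologicalType) (A : vietoris X) (U : set X) :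
  open U -> A `<=` U -> nbhs A [set B : vietoris X | B `<=` U].
Proof.
move=> oU AU; apply: open_nbhs_nbhs; split => //.
exact: (@vietoris_subbase_open X (true, U)).
Qed.

Lemma nbhs_vietoris_meet (X : topologicalType) (A : vietoris X) (U : set X) :
  open U -> A `&` U !=set0 -> nbhs A [set B : vietoris X | B `&` U !=set0].
Proof.
move=> oU AU; apply: open_nbhs_nbhs; split => //.
exact: (@vietoris_subbase_open X (false, U)).
Qed.

Definition triples (X : topologicalType) (P1 P2 P3 : set X) : set (vietoris X) :=
  [set A | exists x y z, [/\ P1 x, P2 y, P3 z & A = [set x; y; z]]].

(** [triples P1 P2 P3] is a continuous image of a compact product. These are the
    compact sets of triples to which properness is applied. *)
Lemma triples_compact (X : topologicalType) (P1 P2 P3 : set X) :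
  compact P1 -> compact P2 -> compact P3 -> compact (triples P1 P2 P3).
Proof.
move=> c1 c2 c3.
pose f (t : X * X * X) : vietoris X := [set t.1.1; t.1.2; t.2].
have -> : triples P1 P2 P3 = f @` (P1 `*` P2 `*` P3).
  apply/seteqP; split => [_ [x [y [z [? ? ? ->]]]]|_ [[[x y] z] [[/= ? ?] ?] <-]].
    by exists (x, y, z).
  by exists x, y, z.
apply: continuous_compact; last by do 2?apply: compact_setX.
apply: continuous_subspaceT => t.
have c11 U : open U -> U t.1.1 -> nbhs t [set s : X * X * X | U s.1.1].
  move=> oU Ut; have c : continuous (fun s : X * X * X => s.1.1).
    by move=> s; apply: (cvg_comp fst fst); exact: cvg_fst.
  exact: (c t _ (open_nbhs_nbhs (conj oU Ut))).
have c12 U : open U -> U t.1.2 -> nbhs t [set s : X * X * X | U s.1.2].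
  move=> oU Ut; have c : continuous (fun s : X * X * X => s.1.2).
    by move=> s; apply: (cvg_comp fst snd); [exact: cvg_fst | exact: cvg_snd].
  exact: (c t _ (open_nbhs_nbhs (conj oU Ut))).
have c02 U : open U -> U t.2 -> nbhs t [set s : X * X * X | U s.2].
  move=> oU Ut; have c : continuous (fun s : X * X * X => s.2).
    by move=> s; exact: cvg_snd.
  exact: (c t _ (open_nbhs_nbhs (conj oU Ut))).
apply: vietoris_cvg => U oU.
  move=> sU; have := c02 U oU (sU _ (or_intror erefl)).
  have := c12 U oU (sU _ (or_introl (or_intror erefl))).
  have := c11 U oU (sU _ (or_introl (or_introl erefl))).
  apply: filterS3 => s s1 s2 s3 w.
  by case=> [[]|] ->.
case=> w [[[]|] -> Uw].
- by apply: filterS (c11 U oU Uw) => s Us; exists s.1.1; split => //; left; left.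
- by apply: filterS (c12 U oU Uw) => s Us; exists s.1.2; split => //; left; right.
- by apply: filterS (c02 U oU Uw) => s Us; exists s.2; split => //; right.
Qed.

Lemma triples_Theta3 (X : topologicalType) (P1 P2 P3 : set X) :
  P1 `&` P2 = set0 -> P1 `&` P3 = set0 -> P2 `&` P3 = set0 ->
  triples P1 P2 P3 `<=` Theta 3 X.
Proof.
move=> P12 P13 P23 _ [x [y [z [x1 y2 z3 ->]]]].
apply: card_set3 => e; subst.
- by have : (P1 `&` P2) y by []; rewrite P12.
- by have : (P1 `&` P3) z by []; rewrite P13.
- by have : (P2 `&` P3) z by []; rewrite P23.
Qed.

Lemma compactum_separate3 (X : topologicalType) (x y z : X) :
  compact [set: X] -> hausdorff_space X -> x <> y -> x <> z -> y <> z ->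
  exists U V W : set X, [/\ [/\ closed U, closed V & closed W],
    [/\ nbhs x U, nbhs y V & nbhs z W] &
    [/\ U `&` V = set0, U `&` W = set0 & V `&` W = set0]].
Proof.
move=> cX hX xy xz yz.
have [U1 [V1 [cU1 cV1 xU1 yV1 UV]]] := compactum_separate cX hX xy.
have [U2 [W2 [cU2 cW2 xU2 zW2 UW]]] := compactum_separate cX hX xz.
have [V3 [W3 [cV3 cW3 yV3 zW3 VW]]] := compactum_separate cX hX yz.
exists (U1 `&` U2), (V1 `&` V3), (W2 `&` W3); split.
- by split; exact: closedI.
- by split; exact: filterI.
- split; apply/seteqP; split => // w [[w1 w2] [w3 w4]].
  + by rewrite -UV.
  + by rewrite -UW.
  + by rewrite -VW.
Qed.

(** * Convergence of graphs to crosses *)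

(** For an ultrafilter [F] this is equivalent to [F] not being principal. *)
Definition nonprincipal (I : Type) (F : set_system I) :=
  forall A, F A -> infinite_set A.

Lemma nonprincipal_ultrafilter (I : Type) (S : set I) : infinite_set S ->
  exists F : set_system I, [/\ UltraFilter F, nonprincipal F & F S].
Proof.
move=> iS; pose B := filter_from (@finite_set I) (fun A => S `\` A).
have PB : ProperFilter B.
  apply: filter_from_proper.
    apply: filter_from_filter; first by exists set0.
    move=> A1 A2 f1 f2; exists (A1 `|` A2); first by rewrite finite_setU.
    by move=> x [Sx n12]; split; split => // h; apply: n12; [left | right].
  move=> A fA; apply/set0P/negP => /eqP; rewrite setD_eq0 => sSA.
  by apply: iS; exact: sub_finite_set fA.
have [F [UF sBF]] := ultraFilterLemma PB; exists F; split => //.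
  move=> A FA fA; have : F (A `&` (S `\` A)).
    by apply: filterI => //; apply: sBF; exists A.
  by rewrite setDE setIA (setIC A) -setIA setICr setI0; exact: filter_not_empty.
by apply: sBF; exists set0 => //; rewrite setD0.
Qed.

Section convergence.
Variables (G : groupType) (X : topologicalType) (b : hgaction G X).
Hypotheses (cX : compact [set: X]) (hX : hausdorff_space X).
Hypothesis properb : proper_on_triples b.

Lemma triples_finite (P1 P2 P3 Q1 Q2 Q3 : set X) :
  closed P1 -> closed P2 -> closed P3 -> closed Q1 -> closed Q2 -> closed Q3 ->
  P1 `&` P2 = set0 -> P1 `&` P3 = set0 -> P2 `&` P3 = set0 ->
  Q1 `&` Q2 = set0 -> Q1 `&` Q3 = set0 -> Q2 `&` Q3 = set0 ->
  finite_set [set g : G | [/\ (exists2 x, P1 x & Q1 (b g x)),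
    (exists2 x, P2 x & Q2 (b g x)) & (exists2 x, P3 x & Q3 (b g x))]].
Proof.
move=> cP1 cP2 cP3 cQ1 cQ2 cQ3 P12 P13 P23 Q12 Q13 Q23.
have cc (A : set X) : closed A -> compact A.
  by move=> cA; apply: (subclosed_compact cA cX).
have KT : triples P1 P2 P3 `|` triples Q1 Q2 Q3 `<=` Theta 3 X.
  by move=> A [|]; exact: triples_Theta3.
have cK : compact (triples P1 P2 P3 `|` triples Q1 Q2 Q3).
  by apply: compactU; apply: triples_compact; exact: cc.
apply: sub_finite_set (properb KT cK) => g [[x x1 gx] [y y2 gy] [z z3 gz]].
exists [set b g x; b g y; b g z]; split; last by right; exists (b g x), (b g y), (b g z).
exists [set x; y; z]; first by left; exists x, y, z.
by rewrite /set_act !image_setU !image_set1.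
Qed.

(** The lower limit of the graphs along [F], in the sense of Kuratowski. *)
Definition limit_graph (F : set_system G) : set (X * X) :=
  [set p | forall W, nbhs p W -> F [set g | exists x, W (x, b g x)]].

Section ultra.
Variable F : set_system G.
Hypotheses (UF : UltraFilter F) (nF : nonprincipal F).
Hypothesis infX : infinite_set [set: X].

(** Points of the graphs in [Z] accumulate, along the ultrafilter, at a point of
    the compact set [Z]. This is what makes [limit_graph F] the limit of the
    graphs rather than only their lower limit. *)
Lemma limit_graph_meets (Z : set (X * X)) : closed Z ->
  F [set g | exists x, Z (x, b g x)] -> exists2 p, Z p & limit_graph F p.
Proof.
move=> cZ FZ; have [g0 [x0 _]] := filter_ex FZ.
(* [h g] is the first coordinate of a point of the graph of [g] in [Z], if any *)
have [h hZ] : {h : G -> X &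
    forall g, (exists x, Z (x, b g x)) -> Z (h g, b g (h g))}.
  apply: (@choice _ _ (fun g x => (exists x, Z (x, b g x)) -> Z (x, b g x))) => g.
  have [[x Zx]|n] := pselect (exists x, Z (x, b g x)); first by exists x.
  by exists x0.
pose k g := (h g, b g (h g)).
have c2 : compact [set: X * X] by rewrite -setXTT; apply: compact_setX.
have cZ' : compact Z by apply: (subclosed_compact cZ c2).
have [p [Zp clp]] := cZ' (k @ F) _ (filterS hZ FZ).
exists p => // W pW.
have [FW|FnW] := in_ultra_setVsetC (k @^-1` W) UF.
  by apply: filterS FW => g kW; exists (h g).
by have [q []] := clp (~` W) W FnW pW.
Qed.

Lemma limit_graph_total (x : X) : exists y, limit_graph F (x, y).
Proof.
have [||[x' y] /= -> ?] := @limit_graph_meets [set p | p.1 = x]; last by exists y.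
  have cx : closed [set x] by apply: compact_closed => //; exact: compact_set1.
  by apply: (@preimage_closed _ _ fst [set x]) => // p _; exact: cvg_fst.
by apply: filterE => g; exists x.
Qed.

Lemma limit_graph_onto (y : X) : exists x, limit_graph F (x, y).
Proof.
have [||[x y'] /= -> ?] := @limit_graph_meets [set p | p.2 = y]; last by exists x.
  have cy : closed [set y] by apply: compact_closed => //; exact: compact_set1.
  by apply: (@preimage_closed _ _ snd [set y]) => // p _; exact: cvg_snd.
by apply: filterE => g; exists (b g^-1%g y); rewrite /= -actM mulgV act1.
Qed.

(** Three pairs of [limit_graph F] in general position have neighborhoods that
    make up two compact sets of triples; the elements of [F]-almost all the group
    would map a triple of the first into the second, against properness. *)
Lemma limit_graph_no_matching (x y z x' y' z' : X) :
  x <> y -> x <> z -> y <> z -> x' <> y' -> x' <> z' -> y' <> z' ->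
  limit_graph F (x, x') -> limit_graph F (y, y') -> limit_graph F (z, z') -> False.
Proof.
move=> xy xz yz xy' xz' yz' Lx Ly Lz.
have [U [V [W [[cU cV cW] [xU yV zW] [UV UW VW]]]]] :=
  compactum_separate3 cX hX xy xz yz.
have [U' [V' [W' [[cU' cV' cW'] [xU' yV' zW'] [UV' UW' VW']]]]] :=
  compactum_separate3 cX hX xy' xz' yz'.
apply: nF (triples_finite cU cV cW cU' cV' cW' UV UW VW UV' UW' VW').
have near2 p p' A A' : nbhs p A -> nbhs p' A' -> limit_graph F (p, p') ->
    F [set g | exists2 q, A q & A' (b g q)].
  move=> pA pA' Lp; have /Lp : nbhs (p, p') (A `*` A') by exists (A, A').
  by apply: filterS => g [q [? ?]]; exists q.
apply: filterS3 (near2 _ _ _ _ xU xU' Lx) (near2 _ _ _ _ yV yV' Ly)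
  (near2 _ _ _ _ zW zW' Lz) => g; exact: And3.
Qed.

(** A choice [h] of preimages takes at most two values when no three pairs of [C]
    are in general position, so one of the fibres of [h] is infinite. *)
Lemma infinite_fibre (C : X -> X -> Prop) :
  (forall x y z x' y' z', x <> y -> x <> z -> y <> z ->
    x' <> y' -> x' <> z' -> y' <> z' -> C x x' -> C y y' -> C z z' -> False) ->
  (forall y, exists x, C x y) -> exists r, infinite_set (C r).
Proof.
move=> noM onto; have [h hC] := choice onto.
have [y1 _] : [set: X] !=set0 by exact: infinite_setN0.
have [alleq|] := pselect (forall y, h y = h y1).
  exists (h y1) => fC; apply: infX; apply: sub_finite_set fC => y _.
  by rewrite -(alleq y).
move=> /existsNP[y2 n21]; apply: contrapT => /forallNP nC.
have f1 := contrapT (nC (h y1)); have f2 := contrapT (nC (h y2)).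
apply: infX; apply: (@sub_finite_set _ _ (C (h y1) `|` C (h y2))).
  move=> y _; have [e1|n1] := pselect (h y = h y1); first by left; rewrite -e1.
  have [e2|n2] := pselect (h y = h y2); first by right; rewrite -e2.
  exfalso; apply: (noM _ _ _ _ _ _ n1 n2 (nesym n21) _ _ _ (hC y) (hC y1) (hC y2)) => e.
  - by apply: n1; rewrite e.
  - by apply: n2; rewrite e.
  - by apply: n21; rewrite e.
by rewrite finite_setU.
Qed.

(** A vertical and a horizontal line contain infinitely many pairs; a pair on
    neither of them could be completed by one on each to three in general
    position. *)
Lemma limit_graph_cross : exists r t, limit_graph F `<=` cross r t.
Proof.
have [r ir] := infinite_fibre limit_graph_no_matching limit_graph_onto.
have [||t it] := @infinite_fibre (fun x y => limit_graph F (y, x)).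
- move=> x y z x' y' z' ? ? ? ? ? ? Lx Ly Lz.
  exact: (limit_graph_no_matching _ _ _ _ _ _ Lx Ly Lz).
- exact: limit_graph_total.
exists r, t => -[p q] Lpq.
have [->|pr] := pselect (p = r); first by left.
have [->|qt] := pselect (q = t); first by right.
exfalso.
have pick (A : set X) (u v : X) : infinite_set A -> exists w, [/\ A w, w <> u & w <> v].
  move=> iA; have : infinite_set (A `\` [set u; v]).
    by apply: infinite_setD => //; exact: finite_set2.
  by move=> /infinite_setN0[w [Aw /not_orP[]]]; exists w.
have [y [Ly yq yt]] := pick _ q t ir; have [x [Lx xp xr]] := pick _ p r it.
exact: (limit_graph_no_matching pr (nesym xp) (nesym xr) (nesym yq) qt yt Lpq Ly Lx).
Qed.

(** The convergence property. The limit of the graphs lies in a cross and projects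
    onto both factors, so it contains every point of the cross except possibly the
    center; the center belongs to it too, because [r] cannot be isolated. *)
Lemma graphs_cvg_cross : exists r t, graph_of b @ F --> cross r t.
Proof.
have [r [t Lrt]] := limit_graph_cross; exists r, t.
have Lp p : p <> r -> limit_graph F (p, t).
  by move=> pr; have [q Lq] := limit_graph_total p; have [] := Lrt _ Lq => //= <-.
have Lq q : q <> t -> limit_graph F (r, q).
  by move=> qt; have [p Lq] := limit_graph_onto q; have [] := Lrt _ Lq => //= <-.
have Lc : limit_graph F (r, t).
  move=> W [[U V] /= [rU tV] UVW].
  have [//|nW] := in_ultra_setVsetC [set g | exists x, W (x, b g x)] UF.
  (* in the other case [r] is isolated, and [b g r] is close to two points at once *)
  have rr : nbhs r [set r].
    apply: filterS (nbhs_interior rU) => x /= xU; apply: contrapT => /Lp /(_ W) FW.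
    have /FW /filterI /(_ nW) /filter_ex[g [] //] : nbhs (x, t) W by exists (U, V).
  have [q1 [q2 [q1t q2t q12]]] : exists q1 q2, [/\ q1 <> t, q2 <> t & q1 <> q2].
    have [q1 [_ q1t]] : ([set: X] `\` [set t]) !=set0.
      by apply: infinite_setN0; exact: infinite_setD.
    have [q2 [_ /not_orP[q2t q21]]] : ([set: X] `\` [set t; q1]) !=set0.
      by apply: infinite_setN0; apply: infinite_setD => //; exact: finite_set2.
    by exists q1, q2; split => // e; apply: q21; rewrite /= e.
  have [V1 [V2 [_ _ q1V q2V V12]]] := compactum_separate cX hX q12.
  have near_r q A : q <> t -> nbhs q A -> F [set g | A (b g r)].
    move=> qt qA; have /(Lq q qt) : nbhs (r, q) ([set r] `*` A) by exists ([set r], A).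
    by apply: filterS => g [_ [/= ->]].
  have [g [g1 g2]] := filter_ex (filterI (near_r _ _ q1t q1V) (near_r _ _ q2t q2V)).
  by have : (V1 `&` V2) (b g r) by []; rewrite V12.
have crossL : cross r t `<=` limit_graph F.
  move=> [p q] /=; rewrite /cross /=.
  have [->|pr] := pselect (p = r); have [->|qt] := pselect (q = t) => //.
  - by move=> _; exact: Lq.
  - by move=> _; exact: Lp.
  - by case.
apply: vietoris_cvg => U oU.
  move=> sU; have [//|FnU] := in_ultra_setVsetC [set g | graph_of b g `<=` U] UF.
  have [||p Up /Lrt /sU //] := @limit_graph_meets (~` U); first exact: open_closedC.
  apply: filterS FnU => g /= /existsNP[[x y] /not_implyP[/= yE nU]].
  by exists x; rewrite -yE.
move=> [p [/crossL Lpq Up]]; have /Lpq : nbhs p U by exact: open_nbhs_nbhs.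
by apply: filterS => g [x Ux]; exists (x, b g x).
Qed.

End ultra.

End convergence.

(** * Conical points *)

Lemma infinite_image (S T : Type) (f : S -> T) (A : set S) :
  injective f -> infinite_set A -> infinite_set (f @` A).
Proof. by move=> fI iA fin; apply: iA; rewrite -(eq_finite_set (inj_card_eq (in2W fI))). Qed.

Lemma open_or_pair (X Y : topologicalType) (U : set X) (V : set Y) :
  open U -> open V -> open [set p : X * Y | U p.1 \/ V p.2].
Proof.
move=> oU oV; apply: (@openU _ (fst @^-1` U) (snd @^-1` V)).
  by apply: open_comp => // p _; exact: cvg_fst.
by apply: open_comp => // p _; exact: cvg_snd.
Qed.

Lemma nbhs_cross (X : topologicalType) (r t : X) (U V : set X) :
  nbhs r U -> nbhs t V ->
  nbhs (cross r t) [set A : vietoris (X * X)%type | forall p, A p -> U p.1 \/ V p.2].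
Proof.
move=> rU tV.
have oUV : open [set p : X * X | U° p.1 \/ V° p.2].
  by apply: open_or_pair; exact: open_interior.
have sUV : cross r t `<=` [set p : X * X | U° p.1 \/ V° p.2].
  by move=> [x y] [] /= ->; [left | right].
apply: (@filterS _ (nbhs (cross r t)) _ _ _ _ (nbhs_vietoris_sub oUV sUV)).
by move=> A sA p /sA [/interior_subset|/interior_subset]; [left | right].
Qed.

Lemma nbhs_cross_meet (X : topologicalType) (r t s : X) (U V : set X) :
  nbhs r U -> nbhs s V ->
  nbhs (cross r t) [set A : vietoris (X * X)%type | exists p, [/\ A p, U p.1 & V p.2]].
Proof.
move=> rU sV.
have oUV : open (U° `*` V°).
  apply: (@openI _ (fst @^-1` U°) (snd @^-1` V°)).
    by apply: open_comp => [p _|]; [exact: cvg_fst | exact: open_interior].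
  by apply: open_comp => [p _|]; [exact: cvg_snd | exact: open_interior].
have crUV : cross r t `&` (U° `*` V°) !=set0.
  by exists (r, s); split; [left | split].
apply: (@filterS _ (nbhs (cross r t)) _ _ _ _ (nbhs_vietoris_meet oUV crUV)).
by move=> A [p [Ap [/interior_subset ? /interior_subset ?]]]; exists p.
Qed.

Section crosses.
Variables (G : groupType) (X : topologicalType) (b : hgaction G X).

Lemma bd_near (S : set G) (r t : X) (U V : set X) :
  bd b S (r, t) -> nbhs r U -> nbhs t V ->
  exists2 g, S g & forall x, U x \/ V (b g x).
Proof.
move=> bdS rU tV; have [_ [[g Sg <-] gUV]] := bdS _ (nbhs_cross rU tV).
by exists g => // x; exact: (gUV (x, b g x) erefl).
Qed.

Hypotheses (cX : compact [set: X]) (hX : hausdorff_space X).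

(** Near the cross, [g] takes [x] close to [t] because [x] is not close to [r]. *)
Lemma bd_attract (S : set G) (r t x : X) (A : set X) :
  bd b S (r, t) -> x <> r -> closed A -> (forall g, S g -> A (b g x)) -> A t.
Proof.
move=> bdS xr cA SA; apply: contrapT => nAt.
have rU : nbhs r (~` [set x]).
  by apply: open_nbhs_nbhs; split; [exact: compactum_open_set1C | exact: nesym].
have tV : nbhs t (~` A) by apply: open_nbhs_nbhs; split => //; exact: closed_openC.
have [g Sg /(_ x)[xx|]] := bd_near bdS rU tV; first exact: xx.
by apply; exact: SA.
Qed.

(** Were [r] isolated, some [g] with graph close to the cross would map [r] close
    to two distinct points at once. *)
Lemma bd0_not_isolated (S : set G) (r : X) : infinite_set [set: X] ->
  bd0 b S r -> ~ nbhs r [set r].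
Proof.
move=> infX [[r' t] bdS /= <-] r'1 {r}.
have [s [_ st]] : ([set: X] `\` [set t]) !=set0.
  by apply: infinite_setN0; exact: infinite_setD.
have [U [V [_ _ sU tV UV]]] := compactum_separate cX hX st.
have [_ [[g Sg <-] [[p [/= pE pr pU]] [q [/= qE qr qV]]]]] :=
  bdS _ (filterI (nbhs_cross_meet t r'1 sU) (nbhs_cross_meet t r'1 tV)).
suff : (U `&` V) (b g r') by rewrite UV.
by split; [rewrite -pr -pE | rewrite -qr -qE].
Qed.

Hypothesis properb : proper_on_triples b.
Hypothesis infX : infinite_set [set: X].

Lemma bd_nonempty (S : set G) : infinite_set S -> bd b S !=set0.
Proof.
move=> /nonprincipal_ultrafilter[F [UF nF FS]].
have [r [t Frt]] := graphs_cvg_cross cX hX properb UF nF infX.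
exists (r, t) => W rtW; have FW : F (graph_of b @^-1` W) := Frt W rtW.
have [g [Sg Wg]] := filter_ex (filterI FS FW).
by exists (graph_of b g); split => //; exists g.
Qed.

(** The criterion by which all conical points are found: [S] takes [y] and [z] away
    from [x]. In a cross [(r, t)] of [bd b S] every point other than [r] is
    attracted to [t]. If [r] were not [x], then [t] would belong to [B] because of
    [x], and to [A] because of the one of [y], [z] that is not [r]. Hence [S] is a
    cone with vertex [x]: [bd1 b S] lies in [A], the images of [x] in [B]. *)
Lemma conical_of_separation (S : set G) (A B : set X) (x y z : X) :
  infinite_set S -> closed A -> closed B -> A `&` B = set0 -> y <> z ->
  (forall g, S g -> [/\ B (b g x), A (b g y) & A (b g z)]) -> conical b x.
Proof.
move=> iS cA cB AB yz hS.
have bdE r t : bd b S (r, t) -> r = x /\ A t.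
  move=> bdS.
  have nxB : x <> r -> B t.
    by move=> xr; apply: (bd_attract bdS xr cB) => g /hS[].
  have nyA : y <> r -> A t.
    by move=> yr; apply: (bd_attract bdS yr cA) => g /hS[].
  have nzA : z <> r -> A t.
    by move=> zr; apply: (bd_attract bdS zr cA) => g /hS[].
  have At : A t.
    by have [yr|/nyA//] := pselect (y = r); apply: nzA; rewrite -yr; exact: nesym.
  split=> //; apply: contrapT => rx.
  suff : (A `&` B) t by rewrite AB.
  by split=> //; apply: nxB; exact: nesym.
have [[r t] bdS] := bd_nonempty iS.
have bd0E : bd0 b S = [set x].
  apply/seteqP; split => [s [[r' t'] /= h <-]|s ->].
    by have [] := bdE _ _ h.
  by exists (r, t) => //=; have [] := bdE _ _ bdS.
exists S; last exact: bd0E.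
split=> //; apply/seteqP; split => // s [[[r' t'] /= /bdE[_ At'] <-]].
rewrite bd0E => clt'; suff : (A `&` B) t' by rewrite AB.
by split => //; apply: cB; apply: closureS clt' => _ [g /hS[Bg _ _] [_ -> <-]].
Qed.

(** Infinitely many [g] that keep [g x] and [g y] apart have a cross [(r, t)] in
    the limit, and [r] is [x] or [y], since otherwise both images tend to [t]. Say
    [r = x]. Then [g y] and the image of any third point [z] tend to [t] while
    [g x] stays away from it, so [x] is conical. *)
Lemma nonconical_perspective (u : set (S2 X)) (x y : X) :
  compact_unif X u -> nonconical b x -> nonconical b y ->
  finite_set [set g | ~ u (upair (b g x) (b g y))].
Proof.
move=> Uu nx ny; apply: contrapT => iS.
have [F [UF nF FS]] := nonprincipal_ultrafilter iS.
have [r [t Frt]] := graphs_cvg_cross cX hX properb UF nF infX.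
have attract w V : w <> r -> nbhs t V -> F [set g | V (b g w)].
  move=> wr tV; have rU : nbhs r (~` [set w]).
    by apply: open_nbhs_nbhs; split; [exact: compactum_open_set1C | exact: nesym].
  have FW : F (graph_of b @^-1` _) := Frt _ (nbhs_cross rU tV).
  apply: filterS FW => g h.
  by have [/(_ erefl)|] := h (w, b g w) erefl.
(* the case where [r] is not the second point; [H x y] and [H y x] suffice *)
have H x' y' : nonconical b x' ->
    F [set g | ~ u (upair (b g x') (b g y'))] -> x' <> y' -> y' <> r -> False.
  move=> nx' Fu xy yr; have [[V W] /= [tV tW] VWu] := Uu t.
  have tVW : nbhs t (V `&` W) by exact: filterI.
  have [xr|xr] := pselect (x' = r); last first.
    have [g [nu [[Vx _] [_ Wy]]]] := filter_ex
      (filterI Fu (filterI (attract _ _ xr tVW) (attract _ _ yr tVW))).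
    by apply: nu; exact: (VWu (_, _)).
  have [A [cA tA AVW]] := closed_nbhs_sub cX hX (nbhs_interior tVW).
  have [z [_ /not_orP[zx zy]]] : ([set: X] `\` [set x'; y']) !=set0.
    by apply: infinite_setN0; apply: infinite_setD => //; exact: finite_set2.
  have zr : z <> r by rewrite -xr.
  have yz : y' <> z by move=> e; exact: zy.
  have FS' : F ([set g | ~ u (upair (b g x') (b g y'))] `&`
      ([set g | A (b g y')] `&` [set g | A (b g z)])).
    by apply: filterI => //; apply: filterI; exact: attract.
  have iS' := nF _ FS'; have cB := open_closedC (@open_interior _ (V `&` W)).
  apply: nx'; apply: (conical_of_separation iS' cA cB _ yz).
    by apply/seteqP; split => // w [/AVW].
  move=> g [/= nu [Ay Az]]; split => // /interior_subset[Vx _].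
  by apply: nu; apply: (VWu (_, _)); split => //; have [_] := interior_subset (AVW _ Ay).
have [xy|xy] := pselect (x = y).
  have [g /=] := filter_ex FS; apply; rewrite xy.
  exact: (compact_unif_diag Uu (ex_intro2 _ _ _ I erefl)).
have [yr|yr] := pselect (y = r); last exact: (H x y).
apply: (H y x) => //; last by rewrite -yr.
  by apply: filterS FS => g /=; rewrite upairC.
exact: nesym.
Qed.

Lemma act_expg (g : G) (n : nat) (x : X) : b (g ^+ n)%g x = iter n (b g) x.
Proof. by elim: n => [|n IH]; rewrite ?expg0 ?act1 // expgS actM IH. Qed.

(** Once in [V] the orbit stays there, so it never returns to [z]. *)
Lemma escaping_orbit (g : G) (V : set X) (z : X) :
  (forall x, V x -> V (b g x)) -> ~ V z -> V (b g z) ->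
  injective (fun n => iter n (b g) z).
Proof.
move=> gV nVz Vgz.
have Viter n : V (iter n.+1 (b g) z) by elim: n => [//|n IH]; exact: gV.
have bI : injective (b g).
  by apply: (can_inj (g := b g^-1%g)) => x; rewrite -actM mulVg act1.
elim=> [|m IH] [|n] //= e.
- by case: nVz; rewrite e; exact: Viter n.
- by case: nVz; rewrite -e; exact: Viter m.
- by rewrite (IH n) //; exact: bI e.
Qed.

(** Here [g] expands [U] and contracts [V]. By compactness some [x] has all its
    images under the positive powers of [g] in [U], while those of [z] and [g z]
    are in [V]; so [x] is conical by [conical_of_separation]. *)
Lemma conical_repelling (g : G) (U V : set X) (z : X) :
  closed U -> closed V -> U `&` V = set0 -> U !=set0 ->
  (forall x, U x -> U (b g^-1%g x)) -> (forall x, V x -> V (b g x)) ->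
  ~ V z -> V (b g z) -> exists2 x, U x & conical b x.
Proof.
move=> cU cV UV [r Ur] gU gV nVz Vgz.
have Viter n : V (iter n.+1 (b g) z) by elim: n => [//|n IH]; exact: gV.
(* [x] is a cluster point of the backward orbit of a point [r] of [U] *)
pose x_ n := iter n (b g^-1%g) r.
have Ux n : U (x_ n) by elim: n => [//|n IH]; exact: gU.
have gx n k : iter n (b g) (x_ (n + k)) = x_ k.
  elim: n => [//|n IH]; rewrite iterSr -[RHS]IH; congr (iter n _ _).
  by rewrite /x_ addSn iterS -actM mulgV act1.
have [x [_ clx]] := @cX (x_ @ \oo) _ filterT.
have Uiter n : U (iter n (b g) x).
  apply: contrapT => nU; have cn : continuous (b (g ^+ n)%g) by exact: hact_continuous.
  have xn : nbhs x (~` (b (g ^+ n)%g @^-1` U)).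
    apply: open_nbhs_nbhs; split; last by rewrite /= act_expg.
    by apply: closed_openC; apply: preimage_closed => // s _; exact: cn.
  have [|s [[m /= nm <-] /=]] := clx [set x_ m | m in [set m | (n <= m)%N]] _ _ xn.
    by exists n => // m nm; exists m.
  by rewrite act_expg -(subnKC nm) gx; apply; exact: Ux.
exists x; first exact: Uiter 0.
pose S := [set (g ^+ n.+1)%g | n in [set: nat]].
have iS : infinite_set S.
  move=> /(finite_image (fun h => b h z)); rewrite image_comp.
  apply: infinite_image infinite_nat => m n /=.
  by rewrite !act_expg => /(escaping_orbit gV nVz Vgz) [].
apply: (conical_of_separation iS cV cU _ (y := b g z) (z := z)).
- by rewrite setIC.
- by move=> e; apply: nVz; rewrite -e.
- move=> _ [n _ <-]; rewrite !act_expg; split => //.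
  by rewrite -iterSr.
Qed.

End crosses.

(** * Pushing elements *)

Lemma third_point (T : Type) (p q : T) : `I_3 #<= [set: T] ->
  exists z, p <> z /\ q <> z.
Proof.
move=> /card_ge3[x [y [z [_ [xy xz yz]]]]]; apply: contrapT => /forallNP h.
have hor w : p = w \/ q = w.
  have [pw|pw] := pselect (p = w); first by left.
  by right; apply: contrapT => qw; exact: (h w).
by case: (hor x) (hor y) (hor z) => [?|?] [?|?] [?|?]; subst.
Qed.

Definition pushes (G : groupType) (X : topologicalType) (a : hgaction G X)
    (g : G) (U V : set X) := forall x, U x \/ V (a g x).

(** A cross [(u, v)] with [u <> v] in the limit of the group yields an element that
    pushes the complement of a neighborhood of [u] into one of [v]. If neither
    limit point offers such a cross, then [(p, p)] and [(q, q)] are in the limit,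
    and elements close to them have a product that pushes the complement of a
    neighborhood of [q] into one of [p]. *)
Lemma limit_points_push (G : groupType) (T : topologicalType)
    (a : hgaction G T) (p q : T) :
  compact [set: T] -> hausdorff_space T -> `I_3 #<= [set: T] ->
  Defs.limit_point a p -> Defs.limit_point a q -> p <> q ->
  exists g U V z, [/\ closed U, closed V & U `&` V = set0] /\
    [/\ U !=set0, ~ U z, ~ V z & pushes a g U V].
Proof.
move=> cT hT T3 [[r p'] bdp /= <-] [[s q'] bdq /= <-] pq {p q}.
have nbhs3 (u v : T) : u <> v -> exists U V z, [/\ closed U, closed V & U `&` V = set0] /\
    [/\ nbhs u U, nbhs v V, ~ U z & ~ V z].
  move=> uv; have [z [uz vz]] := third_point u v T3.
  have [U [V [W [[cU cV _] [uU vV /nbhs_singleton Wz] [UV UW VW]]]]] :=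
    compactum_separate3 cT hT uv uz vz.
  exists U, V, z; split => //; split => // [Uz|Vz].
    by suff : (U `&` W) z by rewrite UW.
  by suff : (V `&` W) z by rewrite VW.
have loxodromic u v : bd a setT (u, v) -> u <> v ->
    exists g U V z, [/\ closed U, closed V & U `&` V = set0] /\
      [/\ U !=set0, ~ U z, ~ V z & pushes a g U V].
  move=> bduv uv; have [U [V [z [cUV [uU vV Uz Vz]]]]] := nbhs3 u v uv.
  have [g _ gUV] := bd_near bduv uU vV.
  exists g, U, V, z; split => //; split => //.
  by exists u; exact: nbhs_singleton.
have [rp|/(loxodromic _ _ bdp)//] := pselect (r = p').
have [sq|/(loxodromic _ _ bdq)//] := pselect (s = q').
subst r s; have [U [V [z [[cU cV UV] [pU qV Uz Vz]]]]] := nbhs3 p' q' pq.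
have [g _ gU] := bd_near bdp pU pU; have [h _ hV] := bd_near bdq qV qV.
exists (g * h)%g, V, U, z; split; first by rewrite setIC.
split=> // [|x]; first by exists q'; exact: nbhs_singleton.
have [Vx|Vhx] := hV x; first by left.
right; rewrite actM; have [Uhx|//] := gU (a h x).
by suff : (U `&` V) (a h x) by rewrite UV.
Qed.

(** * The attractor sum *)

Section attractor_sums.
Variables (G : groupType) (T X : topologicalType).
Variables (a : hgaction G T) (b : hgaction G X) (j : G + T -> X).
Hypothesis asumX : attractor_sum a b j.

Let cX : compact [set: X] := asum_compact asumX.
Let hX : hausdorff_space X := asum_hausdorff asumX.
Let jG (g : G) : X := j (inl g).
Let jT (t : T) : X := j (inr t).

Lemma asum_inj : injective j.
Proof. exact: bij_inj (asum_bij asumX). Qed.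

Lemma asum_surj (x : X) : (exists g, x = jG g) \/ (exists t, x = jT t).
Proof.
have [k _ jk] := asum_bij asumX; rewrite -(jk x).
by case: (k x) => [g|t]; [left; exists g | right; exists t].
Qed.

Lemma asum_continuousT : continuous jT.
Proof.
apply/continuousP => O oO.
have : wopen (fun t : T => j (inr t)) (jT @^-1` O) by exists O.
by rewrite (asum_openT asumX).
Qed.

Hypothesis cT : compact [set: T].

Lemma asum_closed_image (A : set T) : closed A -> closed (jT @` A).
Proof.
move=> cA; apply: compact_closed => //; apply: continuous_compact.
  by apply: continuous_subspaceT => t; exact: asum_continuousT.
exact: subclosed_compact cA cT _.
Qed.

(** The topology induced on the group is discrete, and the group is open in the sum
    as the complement of the compact image of [T]. *)
Lemma asum_isolated (g : G) : open [set jG g].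
Proof.
have : wopen (fun g : G => j (inl g)) [set g] by rewrite (asum_openG asumX).
move=> [O oO OE]; have -> : [set jG g] = O `&` ~` (jT @` setT).
  apply/seteqP; split => [_ ->|x [Ox nT]].
    split; first by have : [set g] g by []; rewrite -OE.
    by case=> t _ /asum_inj.
  have [[h xE]|[t xE]] := asum_surj x; last by case: nT; exists t.
  by have : [set g] h; [rewrite -OE /preimage /=; rewrite xE in Ox | move=> <-].
apply: openI => //; apply: closed_openC; apply: asum_closed_image.
exact: closedT.
Qed.

(** Cocompactness on pairs passes from [T] to the sum [X]. Finitely many pairs of
    open sets separate the pairs of the compact set [K]. One more, the isolated
    point [e] of the neutral element and its complement, separates the translates
    to [e] of all pairs that meet the group. *)
Lemma expansive_entourage : cocompact_on_pairs a ->
  exists u, [/\ compact_unif X u, pair_closed u &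
    forall x y, x <> y -> exists g, ~ u (upair (b g x) (b g y))].
Proof.
move=> [K [K2 cK] KE].
pose meets (i : set X * set X) :=
  [set k : vietoris T | k `&` (jT @^-1` i.1) !=set0 /\ k `&` (jT @^-1` i.2) !=set0].
have [k Kk|F [fF sF KF]] := @compact_finite_cover _ _ K (@closure_disjoint X) meets cK.
  have /card_ge2[x [y [kx ky xy]]] : `I_2 #<= k.
    by have /card_eqPle[_] := K2 k Kk.
  have jxy : jT x <> jT y by move=> /asum_inj [].
  have [i [di ix iy]] := separated_pair cX hX jxy; exists i => //.
  case: di => oi1 oi2 _.
  have near_k (O : set X) z : open O -> k z -> O (jT z) ->
      nbhs k [set k' : vietoris T | k' `&` (jT @^-1` O) !=set0].
    move=> oO kz Oz; apply: nbhs_vietoris_meet; last by exists z.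
    by apply: open_comp => // t _; exact: asum_continuousT.
  by apply: (@filterI _ (nbhs k)); [exact: near_k ix | exact: near_k iy].
pose e := jG 1%g; pose i0 := ([set e], ~` [set e]).
have di0 : closure_disjoint i0.
  have ce : closed [set e] by apply: compact_closed => //; exact: compact_set1.
  split; [exact: asum_isolated | exact: closed_openC |] => /=.
  rewrite -(proj1 (closure_id _) ce) -(proj1 (closure_id _) _) ?setICr //.
  exact: open_closedC (asum_isolated 1%g).
have fF' : finite_set (F `|` [set i0]) by rewrite finite_setU; split.
have dF' i : (F `|` [set i0]) i -> closure_disjoint i.
  by move=> [/sF//|->].
exists (\bigcap_(i in F `|` [set i0]) ~` apart i); split.
- apply: filter_bigcap => //; first exact: compact_unif_filter.
  by move=> i /dF'; exact: apartC_unif.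
- rewrite /pair_closed; have -> : [set p : X * X |
      (\bigcap_(i in F `|` [set i0]) ~` apart i) (upair p.1 p.2)] =
      \bigcap_(i in F `|` [set i0]) [set p | (~` apart i) (upair p.1 p.2)] by [].
  by apply: closed_bigI => i /dF'; exact: apartC_closed.
- have toG h y : y <> jG h ->
      ~ (\bigcap_(i in F `|` [set i0]) ~` apart i) (upair (b h^-1%g (jG h)) (b h^-1%g y)).
    move=> yh /(_ i0 (or_intror erefl)); apply; apply/apart_upair.
    split; first by left; rewrite /jG (asum_actG asumX) mulVg.
    right => /= ye; apply: yh; rewrite -[y](act1 b) -(mulgV h) actM ye.
    by rewrite /e /jG (asum_actG asumX) mulg1.
  move=> x y xy.
  have [[h xE]|[x' xE]] := asum_surj x.
    by exists h^-1%g; rewrite xE; apply: toG => yE; apply: xy; rewrite xE yE.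
  have [[h yE]|[y' yE]] := asum_surj y.
    by exists h^-1%g; rewrite upairC yE; apply: toG; rewrite -yE.
  have xy' : x' <> y' by move=> e'; apply: xy; rewrite xE yE e'.
  have : Theta 2 T [set x'; y'] by exact: card_set2.
  rewrite -KE => -[g _ [k Kk kE]]; exists g^-1%g.
  have jk s : k s -> jT s = b g^-1%g x \/ jT s = b g^-1%g y.
    move=> ks; have : [set x'; y'] (a g s) by rewrite -kE; exists s.
    by rewrite xE yE /jT !(asum_actT asumX) => -[] <-; rewrite -actM mulVg act1; auto.
  have [i Fi [[s [ks si]] [t [kt ti]]]] := KF k Kk.
  move=> /(_ i (or_introl Fi)); apply; split.
    by exists (jT s); split => //=; case: (jk s ks) => ->; [left | right].
  by exists (jT t); split => //=; case: (jk t kt) => ->; [left | right].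
Qed.

End attractor_sums.

Section conical_points.
Variables (G : groupType) (T X : topologicalType).
Variables (a : hgaction G T) (b : hgaction G X) (j : G + T -> X).
Hypothesis asumX : attractor_sum a b j.
Hypothesis cT : compact [set: T].

Let cX : compact [set: X] := asum_compact asumX.
Let hX : hausdorff_space X := asum_hausdorff asumX.
Let jG (g : G) : X := j (inl g).
Let jT (t : T) : X := j (inr t).

Lemma asum_infinite : infinite_set [set: G] -> infinite_set [set: X].
Proof.
move=> iG fX; have jI : injective jG by move=> g h /(asum_inj asumX)[].
by apply: (infinite_image jI iG); exact: sub_finite_set fX.
Qed.

Lemma pushes_inv (g : G) (U V : set T) : pushes a g U V -> pushes a g^-1%g V U.
Proof.
by move=> gUV x; have := gUV (a g^-1%g x); rewrite -actM mulgV act1; case; auto.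
Qed.

(** The images of [U] and [V] in [X] satisfy the hypotheses of [conical_repelling];
    that [X] is infinite follows from the orbit of the image of [z]. *)
Lemma conical_of_push (g : G) (U V : set T) (z : T) :
  closed U -> closed V -> U `&` V = set0 -> U !=set0 -> ~ U z -> ~ V z ->
  pushes a g U V -> exists2 t, U t & conical b (jT t).
Proof.
move=> cU cV UV [r Ur] nUz nVz gUV.
have disj t : U t -> V t -> False by move=> Ut Vt; suff : (U `&` V) t by rewrite UV.
have imT t (A : set T) : (jT @` A) (jT t) -> A t by move=> [s As /(asum_inj asumX)[<-]].
have actT h t : b h (jT t) = jT (a h t) by exact: asum_actT asumX h t.
have gV x : (jT @` V) x -> (jT @` V) (b g x).
  move=> [t Vt <-]; rewrite actT; exists (a g t) => //.
  by have [Ut|//] := gUV t; case: (disj t Ut Vt).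
have Vgz : (jT @` V) (b g (jT z)).
  by rewrite actT; exists (a g z) => //; have [] := gUV z.
have nVz' : ~ (jT @` V) (jT z) by move/imT.
have infX : infinite_set [set: X].
  have iI := escaping_orbit gV nVz' Vgz.
  by move=> fX; apply: (infinite_image iI infinite_nat); exact: sub_finite_set fX.
have [|||_ [t Ut <-] ct] := conical_repelling cX hX (asum_proper asumX) infX
  (asum_closed_image asumX cT cU) (asum_closed_image asumX cT cV) _ _ _ gV nVz' Vgz.
- by apply/seteqP; split => // x [[t Ut <-] /imT]; exact: disj.
- by exists (jT r); exists r.
- move=> x [t Ut <-]; rewrite actT; exists (a g^-1%g t) => //.
  by have [Vt|//] := pushes_inv gUV t; case: (disj t Ut Vt).
- by exists t.
Qed.

(** One conical point in the repelling set of [g], one in that of its inverse. *)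
Lemma two_conical_points : hausdorff_space T -> `I_3 #<= [set: T] ->
  (exists p q, [/\ Defs.limit_point a p, Defs.limit_point a q & p <> q]) ->
  exists c d, [/\ conical b c, conical b d & c <> d].
Proof.
move=> hT T3 [p [q [lp lq pq]]].
have [g [U [V [z [[cU cV UV] [U0 Uz Vz gUV]]]]]] := limit_points_push cT hT T3 lp lq pq.
have [s Us cs] := conical_of_push cU cV UV U0 Uz Vz gUV.
have V0 : V !=set0 by exists (a g z); have [] := gUV z.
have VU : V `&` U = set0 by rewrite setIC.
have [t Vt ct] := conical_of_push cV cU VU V0 Vz Uz (pushes_inv gUV).
exists (jT s), (jT t); split => // /(asum_inj asumX)[st].
suff : (U `&` V) s by rewrite UV.
by split => //; rewrite st.
Qed.

Lemma cone_infinite (c : X) : conical b c -> infinite_set [set: X].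
Proof.
move=> [S [iS _] _]; apply: asum_infinite => fG; apply: iS.
exact: sub_finite_set fG.
Qed.

(** The vertex of a cone is not isolated. *)
Lemma nonconical_group (g : G) : nonconical b (jG g).
Proof.
move=> cg; have infX := cone_infinite cg; case: cg => S _ S0.
apply: (@bd0_not_isolated _ _ b cX hX S (jG g) infX); first by rewrite S0.
by apply: open_nbhs_nbhs; split => //; exact: asum_isolated asumX cT g.
Qed.

(** A cross with vertical line through [c] contains the pair of [c] and the neutral
    element, which is isolated in [X]: graphs close to the cross contain a pair
    of [g^-1] and the neutral element, with [g^-1] close to [c]. *)
Lemma conical_closure (c : X) : conical b c -> closure (nonconical b) c.
Proof.
move=> [S _ S0] N cN; have [[c' t] bdS /= cE] : bd0 b S c by rewrite S0.
subst c'; have e1 : nbhs (jG 1%g) [set jG 1%g].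
  by apply: open_nbhs_nbhs; split => //; exact: asum_isolated asumX cT 1%g.
have [_ [[g Sg <-] [[x y] [/= yE Nx ye]]]] := bdS _ (nbhs_cross_meet t cN e1).
exists x; split => //; have -> : x = jG g^-1%g.
  rewrite -[x](act1 b) -(mulVg g) actM -yE ye.
  by rewrite /jG (asum_actG asumX) mulg1.
exact: nonconical_group.
Qed.

End conical_points.

(** * The boundary of the completion *)

Section boundary.
Variables (X : topologicalType) (A : set X).
Hypotheses (cX : compact [set: X]) (hX : hausdorff_space X).

Let U := induced_unif (A := A) (compact_unif X).

(** The traces on [A] of the neighborhoods of [c]: a point of the completion of [A]
    when [c] is in the closure of [A]. *)
Definition trace (c : X) : set_system A :=
  filter_from (nbhs c) (fun N => val @^-1` N).

Lemma trace_proper (c : X) : closure A c -> ProperFilter (trace c).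
Proof.
move=> clc; apply: filter_from_proper.
  apply: filter_from_filter; first by exists setT; exact: filterT.
  by move=> N1 N2 n1 n2; exists (N1 `&` N2) => //; exact: filterI.
move=> N /clc [x [Ax Nx]]; exists (SigSub (mem_set Ax)); exact: Nx.
Qed.

Lemma trace_cauchy (c : X) : closure A c -> cauchy_filter U (trace c).
Proof.
move=> clc; split; first exact: trace_proper.
move=> v [u Uu uv]; have [[V W] /= [cV cW] VWu] := Uu c.
exists (val @^-1` (V `&` W)); first by exists (V `&` W) => //; exact: filterI.
move=> x y [Vx _] [_ Wy]; apply: uv; rewrite /preimage /= S2map_upair.
by apply: (VWu (_, _)).
Qed.

(** The pairs that lie in [N] if they contain [c]: off [c] this does not constrain
    the pairs close to the diagonal. *)
Lemma point_entourage (c : X) (N : set X) : nbhs c N ->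
  exists2 u, compact_unif X u & forall y, u (upair c y) -> N y.
Proof.
move=> cN; exists [set p : S2 X | sval p c -> sval p `<=` N]; last first.
  by move=> y; apply; [left | right].
move=> x; have [->|xc] := pselect (x = c).
  by exists (N, N) => // -[p q] [/= Np Nq] _ w [->|->].
have xC : nbhs x (~` [set c]).
  by apply: open_nbhs_nbhs; split; first exact: compactum_open_set1C.
by exists (~` [set c], ~` [set c]) => // -[p q] [/= np nq] [] /= e; exfalso;
  [apply: np | apply: nq].
Qed.

Lemma trace_inj (c d : X) : closure A c -> trace c = trace d -> c = d.
Proof.
move=> clc cd; apply: contrapT => /(compactum_separate cX hX) [V [W [_ _ cV dW VW]]].
have PF := trace_proper clc.
have FV : trace c (val @^-1` V) by exists V.
have FW : trace c (val @^-1` W) by rewrite cd; exists W.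
have [x [Vx Wx]] := filter_ex (filterI FV FW).
by suff : (V `&` W) (val x) by rewrite VW.
Qed.

Lemma completion_map_trace (x : A) : completion_map U x = trace (val x).
Proof.
apply/seteqP; split => B.
  move=> [v [u Uu uv] vB]; have [[V W] /= [xV xW] VWu] := Uu (val x).
  exists W => // y Wy; apply: vB; apply: uv; rewrite /preimage /= S2map_upair.
  by apply: (VWu (_, _)); split => //; exact: nbhs_singleton xV.
move=> [N xN NB]; have [u Uu uN] := point_entourage xN.
exists (S2map (fun x : A => val x) @^-1` u); first by exists u.
by move=> y; rewrite /= S2map_upair => /uN; exact: NB.
Qed.

(** A small set [D] of a Cauchy filter below [trace c] comes arbitrarily close to
    [c], hence lies in any given neighborhood of [c]. *)
Lemma trace_minimal (c : X) (F : set_system A) : closure A c ->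
  cauchy_filter U F -> F `<=` trace c -> F = trace c.
Proof.
move=> clc [PF cF] Fc; apply/seteqP; split => // B [N cN NB].
have [u Uu uN] := point_entourage cN.
have [_ _ sU] := compact_unif_uniformity cX hX.
have [v Uv vu] := sU u Uu.
have [|D FD DD] := cF (S2map (fun x : A => val x) @^-1` v); first by exists v.
have PC := trace_proper clc.
have [[V W] /= [cV cW] VWv] := Uv c.
have [m [Dm Wm]] : (D `&` (val @^-1` W)) !=set0.
  by apply: (@filter_ex _ (trace c)); apply: filterI; [exact: Fc | exists W].
apply: filterS FD => y Dy; apply: NB; apply: uN; apply: vu.
apply: (@sq2_upair _ _ _ _ (val m)).
  by apply: (VWv (_, _)); split => //; exact: nbhs_singleton cV.
by have := DD _ _ Dm Dy; rewrite /preimage /= S2map_upair.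
Qed.

Lemma trace_boundary (c : X) : closure A c -> ~ A c -> boundary U (trace c).
Proof.
move=> clc nAc; split.
  by split; [exact: trace_cauchy | move=> F; exact: trace_minimal].
move=> [x _]; rewrite completion_map_trace => /esym/(trace_inj clc) cx.
by apply: nAc; rewrite cx; exact: set_valP.
Qed.

End boundary.

Theorem proposition8p4p1 (G : groupType) (T : topologicalType)
    (a : hgaction G T) (X : topologicalType) (b : hgaction G X)
    (j : G + T -> X)
    (compactT : compact [set: T]) (hausdorffT : hausdorff_space T)
    (cardT : `I_3 #<= [set: T])
    (rh32 : RH32 a)
    (asumX : attractor_sum a b j)
    (connM : connected_gset (nonconical_gset b)) :
  relatively_hyperbolic (nonconical_gset b)
    (induced_unif (A := nonconical b) (compact_unif X)).
Proof.
have [_ cocompa limpts] := rh32.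
have cX := asum_compact asumX; have hX := asum_hausdorff asumX.
have [c [d [cc cd c_d]]] := two_conical_points asumX compactT hausdorffT cardT limpts.
have infX := cone_infinite asumX cc.
have [clc cld] := (conical_closure asumX compactT cc, conical_closure asumX compactT cd).
split=> //.
- exact: induced_uniformity (compact_unif_uniformity cX hX).
- have [u [Uu cu expu]] := expansive_entourage asumX compactT cocompa.
  exists (S2map (fun x : nonconical b => val x) @^-1` u); split.
  + exact: (@expansive_divider _ _ b).
  + move=> p; have [x [y ->]] := S2P p.
    have := nonconical_perspective cX hX (asum_proper asumX) infX Uu
      (set_valP x) (set_valP y).
    by apply: sub_finite_set => g; rewrite /preimage /= !S2map_upair.
  + exact: (@expansive_generated _ _ b).
- exists (trace (A := nonconical b) c), (trace (A := nonconical b) d); split.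
  + by apply: trace_boundary => // nc; exact: nc.
  + by apply: trace_boundary => // nc; exact: nc.
  + by move=> /(trace_inj cX hX clc).
Qed.
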